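(* Consider the problem of minimizing $\mathrm{CVaR}_\alpha[f_\omega(x)]$ over $x\in\mathbb{X}$ subject to $\mathrm{CVaR}_{\beta^i}[g^i_\omega(x)]\le 0$, $i=1,\dots,m$, with risk-aversion parameters $\alpha\in[0,1)$ and $\beta=(\beta^1,\dots,\beta^m)\in[0,1)^m$. Suppose: (a) $\|\nabla f_\omega(x)\|\le C_F$ and $\|\nabla g^i_\omega(x)\|\le C_G^i$ for each $i$, almost surely for all $x\in\mathbb{X}$; (b) $|g^i_\omega(x)|\le D_G^i$ for each $i$ and all $x\in\mathbb{X}$, almost surely; (c) the Lagrangian $\mathcal{L}(x,z)=\mathrm{CVaR}_\alpha[f_\omega(x)]+\sum_{i=1}^m z^i\,\mathrm{CVaR}_{\beta^i}[g^i_\omega(x)]$ admits a saddle point in $\mathbb{X}\times\mathbb{R}^m_+$. For an $\varepsilon$-approximately feasible and optimal solution ($\varepsilon>0$) of this problem, computed by running the primal-dual stochastic subgradient method on the expectation reformulation of the problem (method and reformulation described in the context), let $\gamma_\star(\alpha,\beta)>0$ and $K_\star(\alpha,\beta)$ be the optimized step-size parameter and the optimized iteration count, given by $$\gamma_\star^2=\frac{2P_3^{-1}}{2+y+\sqrt{y^2+8y}},\qquad K_\star=\frac{(P_1+P_2\gamma_\star^2)^2}{16\,\gamma_\star^2(1-P_3\gamma_\star^2)^2\varepsilon^2},\qquad y=1+\frac{P_2}{P_1P_3},$$ where $$P_2=P_2(\alpha,\beta)=\frac{16(C_F^2+1)}{(1-\alpha)^2}+2\left\|\mathrm{diag}(\mathbf{1}+\beta)\,\mathrm{diag}(\mathbf{1}-\beta)^{-1}D_G\right\|^2,$$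 $$P_3=P_3(\alpha,\beta)=16m\left\|\begin{pmatrix}\mathrm{diag}(\mathbf{1}-\beta)^{-1}C_G\\ \mathrm{diag}(\mathbf{1}-\beta)^{-1}\mathbf{1}\end{pmatrix}\right\|^2,$$ $$P_1=2\|w_1-w_\star\|^2+4\|\mathbf{1}+z_\star\|^2,$$ with $w_1$ the initial primal point of the method and $(w_\star,z_\star)$ a saddle point of the Lagrangian $\mathcal{L}'$ of the reformulation. Then $\gamma_\star(\alpha,\beta)$ decreases, and $K_\star(\alpha,\beta)$ increases, with both $\alpha$ and $\beta$.
   Context: $\omega\in\Omega$ is random; $\mathbb{X}\subseteq\mathbb{R}^n$ is closed and convex; $f_\omega,g^1_\omega,\dots,g^m_\omega$ are real-valued and convex (not necessarily differentiable) over $\mathbb{X}$, with subdifferentials nonempty everywhere in $\mathbb{X}$ and $\mathbb{E}|f_\omega(x)|,\mathbb{E}|g^i_\omega(x)|<\infty$ for all $x\in\mathbb{X}$; $\nabla$ denotes a subgradient. For $\delta\in[0,1)$, $\mathrm{CVaR}_\delta[y_\omega]=\min_{u\in\mathbb{R}}\{u+\frac{1}{1-\delta}\mathbb{E}[y_\omega-u]^+\}$ with $[t]^+=\max\{t,0\}$. $C_G=(C_G^1,\dots,C_G^m)$, $D_G=(D_G^1,\dots,D_G^m)$; $\mathbf{1}$ is the all-ones vector; $\|\cdot\|$ is the Euclidean norm; $\mathrm{diag}(v)$ is the diagonal matrix with diagonal $v$. A saddle point of a function $L$ on $A\times\mathbb{R}^m_+$ is a point $(a_\star,z_\star)\in A\times\mathbb{R}^m_+$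 with $L(a_\star,z)\le L(a_\star,z_\star)\le L(a,z_\star)$ for all $(a,z)\in A\times\mathbb{R}^m_+$. Reformulation: with $\psi^h_\omega(x,u;\delta)=u+\frac{1}{1-\delta}[h_\omega(x)-u]^+$, minimize $\mathbb{E}[\psi^f_\omega(x,u^0;\alpha)]$ over $w=(x,u^0,u)\in\mathbb{W}:=\mathbb{X}\times\mathbb{R}\times\{u\in\mathbb{R}^m: |u^i|\le D_G^i \text{ for all } i\}$ subject to $\mathbb{E}[\psi^{g^i}_\omega(x,u^i;\beta^i)]\le 0$, $i=1,\dots,m$. Its Lagrangian is $\mathcal{L}'(w,z)=\mathbb{E}[\psi^f_\omega(x,u^0;\alpha)]+\sum_{i=1}^m z^i\,\mathbb{E}[\psi^{g^i}_\omega(x,u^i;\beta^i)]$ on $\mathbb{W}\times\mathbb{R}^m_+$; it admits a saddle point $(w_\star,z_\star)$ under (a)-(c). Method: start from $w_1\in\mathbb{W}$, $z_1=0$. At iteration $k$, draw a sample $\omega_k$ and set $w_{k+1}$ to the projection on $\mathbb{W}$ of $w_k-\gamma_k\big(\nabla\psi^f_{\omega_k}(w_k)+\sum_i z_k^i\nabla\psi^{g^i}_{\omega_k}(w_k)\big)$; then draw a further sample $\omega_{k+1/2}$ and set $z_{k+1}$ to the projection on $\mathbb{R}^m_+$ of $z_k+\gamma_k\big(\psi^{g^i}_{\omega_{k+1/2}}(w_{k+1})\big)_{i=1}^m$. All samples are i.i.d. With constant step sizes $\gamma_k=\gamma/\sqrt{K}$, $k=1,\dots,K$, $0<\gamma<P_3^{-1/2}$,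 the expected suboptimality and the expected violation of each constraint of the original problem at the average $\frac1K\sum_{k=1}^K x_{k+1}$ are each at most $\frac{P_1+P_2\gamma^2}{4\gamma\sqrt{K}(1-P_3\gamma^2)}$. The pair $(\gamma_\star,K_\star)$ given by the formulas in the claim is the optimal solution of: minimize $K$ over $K$ and $\gamma>0$ subject to this bound being at most $\varepsilon$ and $P_3\gamma^2<1$ (integrality of $K$ ignored). *)

(* Defs.v *)
From HB Require Import structures.
From mathcomp Require Export all_boot all_order all_algebra.
From mathcomp Require Export all_classical all_reals all_analysis.

Set Implicit Arguments.
Unset Strict Implicit.
Unset Printing Implicit Defensive.

Import Order.TTheory GRing.Theory Num.Theory.
Import numFieldNormedType.Exports.

Local Open Scope classical_set_scope.
Local Open Scope ring_scope.

(* The library norm on matrices is the sup norm, hence this definition. *)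
Definition enorm (R : realType) (k : nat) (v : 'cV[R]_k) : R :=
  Num.sqrt (\sum_(i < k) v i 0 ^+ 2).

Definition ones (R : realType) (k : nat) : 'cV[R]_k := const_mx 1.
Arguments ones {R k}.

Definition diag (R : realType) (k : nat) (v : 'cV[R]_k) : 'M[R]_k :=
  diag_mx v^T.

Definition orthant (R : realType) (m : nat) : set 'cV[R]_m :=
  [set z | forall i, 0 <= z i 0].
Arguments orthant {R m}.

(* Subdifferential at x of a function h that is considered on X only. *)
Definition subdifferential (R : realType) (n : nat) (X : set 'cV[R]_n)
    (h : 'cV[R]_n -> R) (x : 'cV[R]_n) : set 'cV[R]_n :=
  [set v | forall y, X y -> h x + (v^T *m (y - x)) 0 0 <= h y].

Definition saddle_point (R : realType) (T : Type) (m : nat) (A : set T)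
    (L : T -> 'cV[R]_m -> R) (a : T) (z : 'cV[R]_m) : Prop :=
  [/\ A a, orthant z &
      forall a' z', A a' -> orthant z' -> L a z' <= L a z /\ L a z <= L a' z].

Section Problem.
Context (R : realType) (d : measure_display) (Omega : measurableType d)
  (P : probability Omega R) (n m : nat).
Implicit Types (f : Omega -> 'cV[R]_n -> R) (g : 'I_m -> Omega -> 'cV[R]_n -> R).
Implicit Types (alpha delta : R) (beta z : 'cV[R]_m).

(* An infimum rather than a minimum: for delta = 0 it is equal to the
   expectation of Y, but need not be attained. *)
Definition CVaR (delta : R) (Y : Omega -> R) : R :=
  inf [set u + (1 - delta)^-1 * \int[P]_omega (Num.max (Y omega - u) 0)
      | u in [set: R]].

Definition lagrangian f g alpha beta (x : 'cV[R]_n) z : R :=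
  CVaR alpha (fun omega => f omega x) +
  \sum_(i < m) z i 0 * CVaR (beta i 0) (fun omega => g i omega x).

Definition psi (delta : R) (h : Omega -> 'cV[R]_n -> R)
    (x : 'cV[R]_n) (u : R) (omega : Omega) : R :=
  u + (1 - delta)^-1 * Num.max (h omega x - u) 0.

(* A primal point w = (x, u0, u) of the reformulation is one stacked vector of
   R^(n + 1 + m), so that its Euclidean norm is enorm w. *)
Definition x_part (w : 'cV[R]_(n + 1 + m)) : 'cV[R]_n := usubmx (usubmx w).
Definition u0_part (w : 'cV[R]_(n + 1 + m)) : R := dsubmx (usubmx w) 0 0.
Definition u_part (w : 'cV[R]_(n + 1 + m)) : 'cV[R]_m := dsubmx w.

Definition reform_domain (X : set 'cV[R]_n) (DG : 'cV[R]_m) :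
    set 'cV[R]_(n + 1 + m) :=
  [set w | X (x_part w) /\ forall i, `|u_part w i 0| <= DG i 0].

Definition reform_lagrangian f g alpha beta (w : 'cV[R]_(n + 1 + m)) z : R :=
  \int[P]_omega psi alpha f (x_part w) (u0_part w) omega +
  \sum_(i < m) z i 0 *
    \int[P]_omega psi (beta i 0) (g i) (x_part w) (u_part w i 0) omega.

End Problem.

Definition risk_params (R : realType) (m : nat) (alpha : R) (beta : 'cV[R]_m) :
    Prop :=
  0 <= alpha < 1 /\ forall i, 0 <= beta i 0 < 1.

Definition cP1 (R : realType) (k m : nat) (w1 wstar : 'cV[R]_k)
    (zstar : 'cV[R]_m) : R :=
  2 * enorm (w1 - wstar) ^+ 2 + 4 * enorm (ones + zstar) ^+ 2.

Definition cP2 (R : realType) (m : nat) (CF : R) (DG : 'cV[R]_m)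
    (alpha : R) (beta : 'cV[R]_m) : R :=
  16 * (CF ^+ 2 + 1) / (1 - alpha) ^+ 2 +
  2 * enorm (diag (ones + beta) *m invmx (diag (ones - beta)) *m DG) ^+ 2.

Definition cP3 (R : realType) (m : nat) (CG : 'cV[R]_m)
    (beta : 'cV[R]_m) : R :=
  16 * m%:R *
  enorm (col_mx (invmx (diag (ones - beta)) *m CG)
                (invmx (diag (ones - beta)) *m ones)) ^+ 2.

(* gamma_star is the positive number whose square is the quantity under the
   outer square root. *)
Definition gamma_star (R : realType) (P1 P2 P3 : R) : R :=
  let y := 1 + P2 / (P1 * P3) in
  Num.sqrt (2 * P3^-1 / (2 + y + Num.sqrt (y ^+ 2 + 8 * y))).

Definition K_star (R : realType) (eps P1 P2 P3 : R) : R :=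
  let gam := gamma_star P1 P2 P3 in
  (P1 + P2 * gam ^+ 2) ^+ 2 /
  (16 * gam ^+ 2 * (1 - P3 * gam ^+ 2) ^+ 2 * eps ^+ 2).

(* Main.v *)
(* For fixed P1, the iteration count needed with step size g is the square of
   (P1 + P2 g^2) / (4 eps g (1 - P3 g^2)), which at every admissible g increases
   with P2 and P3, so its minimum over g increases as well.  The minimizer is the
   positive root of P2 P3 g^4 + (P2 + 3 P1 P3) g^2 = P1, whose left-hand side
   increases with g, P2 and P3, so the root decreases with P2 and P3.  It remains
   that P2 and P3 are monotone in the risk parameters, P2 strictly in alpha and
   P3 strictly in each beta^i, and that P1 > 0. *)
Require Import Defs.
From mathcomp Require Import ring lra.

Set Implicit Arguments.
Unset Strict Implicit.
Unset Printing Implicit Defensive.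

Import Order.TTheory GRing.Theory Num.Theory.
Import numFieldNormedType.Exports.

Local Open Scope classical_set_scope.
Local Open Scope ring_scope.

(** * Optimized step size and iteration count as functions of the constants *)

Section StepSize.
Variable R : realType.

Lemma gamma_star_gt0 (P1 P2 P3 : R) :
  0 < P1 -> 0 < P2 -> 0 < P3 -> 0 < gamma_star P1 P2 P3.
Proof.
move=> P1_gt0 P2_gt0 P3_gt0; rewrite /gamma_star sqrtr_gt0.
have q_gt0 : 0 < P2 / (P1 * P3) by rewrite divr_gt0 ?mulr_gt0.
rewrite divr_gt0 ?mulr_gt0 ?invr_gt0 //.
by rewrite ltr_wpDr ?sqrtr_ge0 //; lra.
Qed.

(** The equation is the vanishing of the numerator of the derivative of
    [(P1 + P2 s^2) / (s (1 - P3 s^2))], with [t = s^2]; the closed form of [gamma_star] is its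
    positive root with rationalized numerator. *)
Lemma gamma_star_root (P1 P2 P3 : R) (t := gamma_star P1 P2 P3 ^+ 2) :
  0 < P1 -> 0 < P2 -> 0 < P3 -> P2 * P3 * t ^+ 2 + (P2 + 3 * P1 * P3) * t = P1.
Proof.
move=> P1_gt0 P2_gt0 P3_gt0.
have q_gt0 : 0 < P2 / (P1 * P3) by rewrite divr_gt0 ?mulr_gt0.
rewrite /t /gamma_star; set y := 1 + _.
have y_gt0 : 0 < y by rewrite /y; lra.
have disc_ge0 : 0 <= y ^+ 2 + 8 * y by nra.
set r := Num.sqrt (y ^+ 2 + 8 * y).
have r_ge0 : 0 <= r by exact: sqrtr_ge0.
have r2 : r ^+ 2 = y ^+ 2 + 8 * y by exact: sqr_sqrtr.
have den_gt0 : 0 < 2 + y + r by lra.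
have P2E : P2 = (y - 1) * (P1 * P3).
  by rewrite /y; field; rewrite !gt_eqF.
rewrite sqr_sqrtr; last by rewrite divr_ge0 ?mulr_ge0 ?invr_ge0 // ltW.
rewrite P2E; apply/eqP; rewrite -subr_eq0; apply/eqP.
(* Once [P2] is eliminated through [y], the residual of the equation is a multiple of
   [y^2 + 8 y - r^2]. *)
transitivity (P1 * (y ^+ 2 + 8 * y - r ^+ 2) / (2 + y + r) ^+ 2).
  by field; rewrite !gt_eqF.
by rewrite r2 subrr mulr0 mul0r.
Qed.

(** All terms of the root equation are positive, so [3 P1 P3 t < P1], and even [P3 t < 1/3]. *)
Lemma gamma_star_admissible (P1 P2 P3 : R) : 0 < P1 -> 0 < P2 -> 0 < P3 ->
  P3 * gamma_star P1 P2 P3 ^+ 2 < 1.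
Proof.
move=> P1_gt0 P2_gt0 P3_gt0.
have := gamma_star_root P1_gt0 P2_gt0 P3_gt0.
have : 0 < gamma_star P1 P2 P3 ^+ 2 by rewrite exprn_gt0 ?gamma_star_gt0.
move: (_ ^+ 2) => t t_gt0 root_t.
have : 0 < P2 * P3 * t ^+ 2 by rewrite !mulr_gt0 ?exprn_gt0.
have : 0 < P2 * t by rewrite mulr_gt0.
have : 0 < P3 * t by rewrite mulr_gt0.
by move=> *; nra.
Qed.

Lemma gamma_star_lt (P1 P2 P3 P2' P3' : R) :
  0 < P1 -> 0 < P2 -> 0 < P3 -> P2 <= P2' -> P3 <= P3' ->
  (P2 < P2') || (P3 < P3') ->
  gamma_star P1 P2' P3' < gamma_star P1 P2 P3.
Proof.
move=> P1_gt0 P2_gt0 P3_gt0 le2 le3 lt23.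
have P2'_gt0 := lt_le_trans P2_gt0 le2; have P3'_gt0 := lt_le_trans P3_gt0 le3.
have := gamma_star_root P1_gt0 P2_gt0 P3_gt0.
have := gamma_star_root P1_gt0 P2'_gt0 P3'_gt0.
have g_gt0 := gamma_star_gt0 P1_gt0 P2_gt0 P3_gt0.
have g'_gt0 := gamma_star_gt0 P1_gt0 P2'_gt0 P3'_gt0.
rewrite -ltr_sqr ?nnegrE ?ltW //.
have := exprn_gt0 2 g_gt0; have := exprn_gt0 2 g'_gt0.
move: (gamma_star _ _ _ ^+ 2) (gamma_star _ _ _ ^+ 2) => t t' t'_gt0 t_gt0.
move=> root' root; rewrite ltNge; apply/negP => le_t.
(* Strictness comes from the linear coefficient, which grows strictly with either constant; the
   quadratic term is compared weakly. *)
have lt_lin : P2 + 3 * P1 * P3 < P2' + 3 * P1 * P3'.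
  by case/orP: lt23 => ?; nra.
have le_quad : P2 * P3 * t ^+ 2 <= P2' * P3' * t' ^+ 2.
  have le_sqr : t ^+ 2 <= t' ^+ 2 by rewrite ler_sqr ?nnegrE // ltW.
  have le_P23 : P2 * P3 <= P2' * P3' by rewrite ler_pM // ltW.
  by rewrite ler_pM ?sqr_ge0 // ltW // mulr_gt0.
have : (P2 + 3 * P1 * P3) * t < (P2' + 3 * P1 * P3') * t'.
  apply: (@le_lt_trans _ _ ((P2 + 3 * P1 * P3) * t')).
    by rewrite ler_wpM2l // addr_ge0 ?mulr_ge0 // ltW.
  by rewrite ltr_pM2r.
lra.
Qed.

(** The error bound of the method at step parameter [s], multiplied by [4 sqrt K]. *)
Definition step_bound (P1 P2 P3 s : R) : R :=
  (P1 + P2 * s ^+ 2) / (s * (1 - P3 * s ^+ 2)).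

Lemma K_starE (eps P1 P2 P3 : R) :
  K_star eps P1 P2 P3 =
  (step_bound P1 P2 P3 (gamma_star P1 P2 P3) / (4 * eps)) ^+ 2.
Proof.
rewrite /K_star /step_bound; move: (gamma_star _ _ _) => s.
rewrite -[in RHS]mulrA -invfM expr_div_n.
by congr (_ / _); ring.
Qed.

Lemma step_bound_gt0 (P1 P2 P3 s : R) : 0 < P1 -> 0 < P2 -> 0 < s ->
  P3 * s ^+ 2 < 1 -> 0 < step_bound P1 P2 P3 s.
Proof.
move=> P1_gt0 P2_gt0 s_gt0 adm.
by rewrite divr_gt0 ?addr_gt0 ?mulr_gt0 ?exprn_gt0 ?subr_gt0.
Qed.

Lemma step_bound_lt (P1 P2 P3 P2' P3' s : R) :
  0 < P1 -> 0 < P2 -> 0 < s -> P2 <= P2' -> P3 <= P3' ->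
  (P2 < P2') || (P3 < P3') -> P3' * s ^+ 2 < 1 ->
  step_bound P1 P2 P3 s < step_bound P1 P2' P3' s.
Proof.
move=> P1_gt0 P2_gt0 s_gt0 le2 le3 lt23 adm'.
have s2_gt0 : 0 < s ^+ 2 by rewrite exprn_gt0.
have adm : P3 * s ^+ 2 < 1 by rewrite (le_lt_trans _ adm') // ler_pM2r.
have num_le : P1 + P2 * s ^+ 2 <= P1 + P2' * s ^+ 2 by rewrite lerD2l ler_pM2r.
have num_gt0 : 0 < P1 + P2 * s ^+ 2 by rewrite addr_gt0 ?mulr_gt0.
have den_gt0 : 0 < s * (1 - P3 * s ^+ 2) by rewrite mulr_gt0 ?subr_gt0.
have den'_gt0 : 0 < s * (1 - P3' * s ^+ 2) by rewrite mulr_gt0 ?subr_gt0.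
have den_le : s * (1 - P3' * s ^+ 2) <= s * (1 - P3 * s ^+ 2).
  by rewrite ler_pM2l // lerD2l lerN2 ler_pM2r.
(* Numerator and denominator change one at a time, the one known to change strictly first. *)
rewrite /step_bound; case/orP: lt23 => [lt2|lt3].
  apply: (@lt_le_trans _ _ ((P1 + P2' * s ^+ 2) / (s * (1 - P3 * s ^+ 2)))).
    by rewrite ltr_pM2r ?invr_gt0 // ltrD2l ltr_pM2r.
  by rewrite ler_pM2l ?lef_pV2 ?posrE // (lt_le_trans num_gt0).
apply: (@lt_le_trans _ _ ((P1 + P2 * s ^+ 2) / (s * (1 - P3' * s ^+ 2)))).
  by rewrite ltr_pM2l ?ltf_pV2 ?posrE // ltr_pM2l // ltrD2l ltrN2 ltr_pM2r.
by rewrite ler_pM2r ?invr_gt0.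
Qed.

(** With [c] the value at the root [s0], the claim is that the cubic
    [P1 + P2 s^2 - c s (1 - P3 s^2)] is nonnegative at [s]; it factors as a square times a positive
    term. *)
Lemma step_bound_min (P1 P2 P3 s : R) : 0 < P1 -> 0 < P2 -> 0 < P3 ->
  0 < s -> P3 * s ^+ 2 < 1 ->
  step_bound P1 P2 P3 (gamma_star P1 P2 P3) <= step_bound P1 P2 P3 s.
Proof.
move=> P1_gt0 P2_gt0 P3_gt0 s_gt0 adm.
have := gamma_star_root P1_gt0 P2_gt0 P3_gt0.
have := gamma_star_admissible P1_gt0 P2_gt0 P3_gt0.
have := gamma_star_gt0 P1_gt0 P2_gt0 P3_gt0.
move: (gamma_star _ _ _) => s0 s0_gt0 adm0 root.
have c_gt0 := step_bound_gt0 P1_gt0 P2_gt0 s0_gt0 adm0.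
have cE : step_bound P1 P2 P3 s0 * (s0 * (1 - P3 * s0 ^+ 2)) = P1 + P2 * s0 ^+ 2.
  by rewrite /step_bound divfK // gt_eqF // mulr_gt0 // subr_gt0.
move: (step_bound _ _ _ s0) c_gt0 cE => c c_gt0 cE.
rewrite /step_bound ler_pdivlMr ?mulr_gt0 ?subr_gt0 //.
(* Eliminating [P2] between the vanishing of the cubic and of its derivative at [s0] gives [c2]. *)
have c2 : c * s0 * (1 + P3 * s0 ^+ 2) = 2 * P1.
  apply: (@mulIf _ (1 - P3 * s0 ^+ 2)); first by rewrite gt_eqF // subr_gt0.
  transitivity ((1 + P3 * s0 ^+ 2) * (c * (s0 * (1 - P3 * s0 ^+ 2)))).
    by ring.
  by rewrite cE; nra.
have P2E : P2 * s0 ^+ 2 = P1 - 2 * c * P3 * s0 ^+ 3 by nra.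
(* The cubic P1 + P2 s^2 - c s (1 - P3 s^2) vanishes doubly at s0. *)
have cubicE : s0 ^+ 2 * (P1 + P2 * s ^+ 2 - c * (s * (1 - P3 * s ^+ 2))) =
    (s - s0) ^+ 2 * (c * P3 * s * s0 ^+ 2 + P1).
  transitivity (s0 ^+ 2 * P1 + s ^+ 2 * (P2 * s0 ^+ 2)
    - c * s0 ^+ 2 * s * (1 - P3 * s ^+ 2)); first by ring.
  rewrite P2E.
  have -> : c * s0 ^+ 2 * s * (1 - P3 * s ^+ 2) =
    (c * s0 * (1 + P3 * s0 ^+ 2)) * s0 * s
    - c * s0 ^+ 2 * s * P3 * (s ^+ 2 + s0 ^+ 2) by ring.
  by rewrite c2; ring.
rewrite -subr_ge0 -(pmulr_rge0 _ (exprn_gt0 2 s0_gt0)) cubicE.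
by rewrite mulr_ge0 ?sqr_ge0 ?addr_ge0 ?mulr_ge0 ?sqr_ge0 // ltW.
Qed.

(** The new optimal step is also admissible for the old constants: the old minimum is at most the
    old bound at that step, which is strictly below the new bound there. *)
Lemma K_star_lt (eps P1 P2 P3 P2' P3' : R) : 0 < eps ->
  0 < P1 -> 0 < P2 -> 0 < P3 -> P2 <= P2' -> P3 <= P3' ->
  (P2 < P2') || (P3 < P3') ->
  K_star eps P1 P2 P3 < K_star eps P1 P2' P3'.
Proof.
move=> eps_gt0 P1_gt0 P2_gt0 P3_gt0 le2 le3 lt23.
have P2'_gt0 := lt_le_trans P2_gt0 le2; have P3'_gt0 := lt_le_trans P3_gt0 le3.
have g_gt0 := gamma_star_gt0 P1_gt0 P2_gt0 P3_gt0.
have adm := gamma_star_admissible P1_gt0 P2_gt0 P3_gt0.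
have g'_gt0 := gamma_star_gt0 P1_gt0 P2'_gt0 P3'_gt0.
have adm' := gamma_star_admissible P1_gt0 P2'_gt0 P3'_gt0.
have b_gt0 := step_bound_gt0 P1_gt0 P2_gt0 g_gt0 adm.
have b'_gt0 := step_bound_gt0 P1_gt0 P2'_gt0 g'_gt0 adm'.
have e_gt0 : 0 < 4 * eps by rewrite mulr_gt0.
rewrite !K_starE ltr_sqr ?nnegrE ?(ltW (divr_gt0 _ _)) // ltr_pM2r ?invr_gt0 //.
apply: le_lt_trans (step_bound_lt P1_gt0 P2_gt0 g'_gt0 le2 le3 lt23 adm').
apply: step_bound_min => //.
by rewrite (le_lt_trans _ adm') // ler_pM2r // exprn_gt0.
Qed.

End StepSize.

(** * Positivity and coordinate forms of the constants *)

Section Constants.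
Variables (R : realType) (m : nat).
Implicit Types (b : 'cV[R]_m) (a CF : R).

Lemma enorm_sqr k (v : 'cV[R]_k) : enorm v ^+ 2 = \sum_(i < k) v i 0 ^+ 2.
Proof. by rewrite sqr_sqrtr // sumr_ge0 // => i _; exact: sqr_ge0. Qed.

Lemma diag_mulE (w v : 'cV[R]_m) i : (diag w *m v) i 0 = w i 0 * v i 0.
Proof. by rewrite mul_diag_mx !mxE. Qed.

Lemma invmx_diag_mulE (w v : 'cV[R]_m) i : (forall j, w j 0 != 0) ->
  (invmx (diag w) *m v) i 0 = v i 0 / w i 0.
Proof.
move=> w_neq0.
have diag_unit : diag w \in unitmx.
  rewrite unitmxE det_diag unitfE; apply/prodf_neq0 => j _.
  by rewrite mxE.
have vE : v i 0 = w i 0 * (invmx (diag w) *m v) i 0.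
  by rewrite -diag_mulE mulKVmx.
by rewrite vE mulrC mulKf.
Qed.

(** Since [zstar] is nonnegative, each coordinate of [ones + zstar] is at least 1, and [0 < m]
    provides a coordinate. *)
Lemma cP1_gt0 k (w1 wstar : 'cV[R]_k) (zstar : 'cV[R]_m) :
  (0 < m)%N -> orthant zstar -> 0 < cP1 w1 wstar zstar.
Proof.
move=> m_gt0 z_ge0; rewrite /cP1 ltr_wpDl 1?mulr_ge0 ?sqr_ge0 //.
rewrite mulr_gt0 // enorm_sqr (bigD1 (Ordinal m_gt0)) //= ltr_pwDl //.
  by rewrite !mxE exprn_gt0 // ltr_pwDl.
by rewrite sumr_ge0 // => i _; rewrite sqr_ge0.
Qed.

Lemma cP2E CF (DG : 'cV[R]_m) a b : risk_params a b ->
  cP2 CF DG a b = 16 * (CF ^+ 2 + 1) / (1 - a) ^+ 2 +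
    2 * \sum_(i < m) ((1 + b i 0) / (1 - b i 0)) ^+ 2 * DG i 0 ^+ 2.
Proof.
move=> [_ b01]; rewrite /cP2 enorm_sqr; congr (_ + 2 * _).
apply: eq_bigr => i _; rewrite -mulmxA diag_mulE invmx_diag_mulE; last first.
  by move=> j; rewrite !mxE gt_eqF // subr_gt0; case/andP: (b01 j).
by rewrite !mxE -exprMn; congr (_ ^+ 2); rewrite mulrCA mulrC.
Qed.

(** The two stacked blocks share the weight [(1 - b i 0)^-1], so their squares combine into the
    coefficient [CG i 0 ^+ 2 + 1], positive for every [CG]. *)
Lemma cP3E (CG : 'cV[R]_m) a b : risk_params a b ->
  cP3 CG b =
  16 * m%:R * \sum_(i < m) (CG i 0 ^+ 2 + 1) * ((1 - b i 0)^-1) ^+ 2.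
Proof.
move=> [_ b01]; rewrite /cP3 enorm_sqr; congr (_ * _).
have b_neq0 j : (ones - b) j 0 != 0.
  by rewrite !mxE gt_eqF // subr_gt0; case/andP: (b01 j).
rewrite big_split_ord /= -big_split; apply: eq_bigr => i _ /=.
rewrite col_mxEu col_mxEd !invmx_diag_mulE // !mxE.
by rewrite !exprMn expr1n mulrDl.
Qed.

Lemma cP2_gt0 CF (DG : 'cV[R]_m) a b : risk_params a b -> 0 < cP2 CF DG a b.
Proof.
move=> [/andP[_ a_lt1] _]; rewrite /cP2 ltr_pwDl 1?mulr_ge0 ?sqr_ge0 //.
by rewrite divr_gt0 ?exprn_gt0 ?subr_gt0 // mulr_gt0 // ltr_wpDl ?sqr_ge0.
Qed.

Lemma cP3_gt0 (CG : 'cV[R]_m) a b : (0 < m)%N -> risk_params a b ->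
  0 < cP3 CG b.
Proof.
move=> m_gt0 rp; rewrite (cP3E _ rp) !mulr_gt0 ?ltr0n //.
have term_gt0 i : 0 < (CG i 0 ^+ 2 + 1) * (1 - b i 0)^-1 ^+ 2.
  rewrite mulr_gt0 ?ltr_wpDl ?sqr_ge0 // exprn_gt0 // invr_gt0 subr_gt0.
  by case: rp => _ /(_ i) /andP[].
rewrite (bigD1 (Ordinal m_gt0)) //= ltr_pwDl //.
by rewrite sumr_ge0 // => i _; rewrite ltW.
Qed.

Lemma ltf_onem_inv_sqr (x y : R) : y < 1 -> x < y ->
  (1 - x)^-1 ^+ 2 < (1 - y)^-1 ^+ 2.
Proof.
move=> y_lt1 lt_xy; have x_lt1 := lt_trans lt_xy y_lt1.
by rewrite ltr_sqr ?nnegrE ?invr_ge0 ?subr_ge0 ?(ltW x_lt1) ?(ltW y_lt1) //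
  ltf_pV2 ?posrE ?subr_gt0 // ltrD2l ltrN2.
Qed.

Lemma lef_onem_inv_sqr (x y : R) : y < 1 -> x <= y ->
  (1 - x)^-1 ^+ 2 <= (1 - y)^-1 ^+ 2.
Proof.
move=> y_lt1; rewrite le_eqVlt => /predU1P[-> //|lt_xy].
exact/ltW/ltf_onem_inv_sqr.
Qed.

(** * Monotonicity of the constants in the risk parameters *)

Variables (a a' : R) (b b' : 'cV[R]_m).
Hypotheses (rp : risk_params a b) (rp' : risk_params a' b').
Hypotheses (le_a : a <= a') (le_b : forall i, b i 0 <= b' i 0).

Let b_ge0 i : 0 <= b i 0. Proof. by case: rp => _ /(_ i) /andP[]. Qed.
Let b_lt1 i : b i 0 < 1. Proof. by case: rp => _ /(_ i) /andP[]. Qed.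
Let b'_lt1 i : b' i 0 < 1. Proof. by case: rp' => _ /(_ i) /andP[]. Qed.
Let a'_lt1 : a' < 1. Proof. by case: rp' => /andP[]. Qed.

Let sumD_le (DG : 'cV[R]_m) :
  2 * \sum_(i < m) ((1 + b i 0) / (1 - b i 0)) ^+ 2 * DG i 0 ^+ 2 <=
  2 * \sum_(i < m) ((1 + b' i 0) / (1 - b' i 0)) ^+ 2 * DG i 0 ^+ 2.
Proof.
rewrite ler_pM2l // ler_sum // => i _; rewrite ler_wpM2r ?sqr_ge0 // !exprMn.
have b'_ge0 := le_trans (b_ge0 i) (le_b i).
by rewrite ler_pM ?sqr_ge0 ?lef_onem_inv_sqr // ler_sqr ?nnegrE ?addr_ge0 ?lerD2l.
Qed.

Lemma cP2_le CF (DG : 'cV[R]_m) : cP2 CF DG a b <= cP2 CF DG a' b'.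
Proof.
rewrite (cP2E _ _ rp) (cP2E _ _ rp') lerD // -!exprVn.
by rewrite ler_wpM2l 1?mulr_ge0 ?addr_ge0 ?sqr_ge0 // lef_onem_inv_sqr.
Qed.

(** The term in [alpha] has the positive coefficient [16 (CF^2 + 1)] and gives strictness; the
    [beta] sum is compared only weakly, as [DG] may vanish. *)
Lemma cP2_lt CF (DG : 'cV[R]_m) : a < a' -> cP2 CF DG a b < cP2 CF DG a' b'.
Proof.
move=> lt_a; rewrite (cP2E _ _ rp) (cP2E _ _ rp') ltr_leD // -!exprVn.
by rewrite ltr_pM2l ?ltf_onem_inv_sqr // mulr_gt0 ?ltr_wpDl ?sqr_ge0.
Qed.

Lemma cP3_le (CG : 'cV[R]_m) : cP3 CG b <= cP3 CG b'.
Proof.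
rewrite (cP3E _ rp) (cP3E _ rp') ler_wpM2l 1?mulr_ge0 // ler_sum // => i _.
by rewrite ler_wpM2l ?addr_ge0 ?sqr_ge0 // lef_onem_inv_sqr.
Qed.

Lemma cP3_lt (CG : 'cV[R]_m) i : b i 0 < b' i 0 -> cP3 CG b < cP3 CG b'.
Proof.
move=> lt_bi; rewrite (cP3E _ rp) (cP3E _ rp') ltr_pM2l; last first.
  by rewrite mulr_gt0 // ltr0n (leq_ltn_trans _ (ltn_ord i)).
rewrite (bigD1 i) // [ltRHS](bigD1 i) //= ltr_leD //.
  by rewrite ltr_pM2l ?ltf_onem_inv_sqr // ltr_wpDl ?sqr_ge0.
by rewrite ler_sum // => j _; rewrite ler_wpM2l ?addr_ge0 ?sqr_ge0 // lef_onem_inv_sqr.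
Qed.

End Constants.

(* P1 depends on the risk parameters only through the saddle point of the
   problem at hand, whose parameters are alpha and beta; it is a constant when
   gamma_star and K_star are regarded as functions of the risk parameters. *)
Theorem proposition3p2
  (R : realType) (d : measure_display) (Omega : measurableType d)
  (P : probability Omega R) (n m : nat) (m_gt0 : (0 < m)%N)
  (X : set 'cV[R]_n) (X_closed : closed X) (X_convex : convex_set X)
  (f : Omega -> 'cV[R]_n -> R) (g : 'I_m -> Omega -> 'cV[R]_n -> R)
  (f_convex : forall omega, convex_function X (f omega))
  (g_convex : forall i omega, convex_function X (g i omega))
  (f_subdiff : forall omega x, X x ->
     subdifferential X (f omega) x !=set0)
  (g_subdiff : forall i omega x, X x ->
     subdifferential X (g i omega) x !=set0)
  (f_integrable : forall x, X x ->
     P.-integrable [set: Omega] (fun omega => (f omega x)%:E))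
  (g_integrable : forall i x, X x ->
     P.-integrable [set: Omega] (fun omega => (g i omega x)%:E))
  (grad_f : Omega -> 'cV[R]_n -> 'cV[R]_n)
  (grad_g : 'I_m -> Omega -> 'cV[R]_n -> 'cV[R]_n)
  (grad_fP : forall omega x, X x ->
     subdifferential X (f omega) x (grad_f omega x))
  (grad_gP : forall i omega x, X x ->
     subdifferential X (g i omega) x (grad_g i omega x))
  (CF : R) (CG DG : 'cV[R]_m)
  (CF_bound : {ae P, forall omega, forall x, X x ->
     enorm (grad_f omega x) <= CF})
  (CG_bound : forall i, {ae P, forall omega, forall x, X x ->
     enorm (grad_g i omega x) <= CG i 0})
  (DG_bound : forall i x, X x ->
     {ae P, forall omega, `|g i omega x| <= DG i 0})
  (alpha : R) (beta : 'cV[R]_m) (alpha_beta : risk_params alpha beta)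
  (L_saddle : exists x z, saddle_point X (lagrangian P f g alpha beta) x z)
  (w1 wstar : 'cV[R]_(n + 1 + m)) (zstar : 'cV[R]_m)
  (w1_dom : reform_domain X DG w1)
  (wz_saddle : saddle_point (reform_domain X DG)
     (reform_lagrangian P f g alpha beta) wstar zstar)
  (eps : R) (eps_gt0 : 0 < eps) :
  let P1 := cP1 w1 wstar zstar in
  let gam a b := gamma_star P1 (cP2 CF DG a b) (cP3 CG b) in
  let K a b := K_star eps P1 (cP2 CF DG a b) (cP3 CG b) in
  forall (a a' : R) (b b' : 'cV[R]_m),
    risk_params a b -> risk_params a' b' ->
    a <= a' -> (forall i, b i 0 <= b' i 0) -> (a, b) <> (a', b') ->
    gam a' b' < gam a b /\ K a b < K a' b'.
Proof.
move=> P1 gam K a a' b b' rp rp' le_a le_b neq_ab.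
have P1_gt0 : 0 < P1 by apply: cP1_gt0 => //; case: wz_saddle.
have P2_gt0 := cP2_gt0 CF DG rp; have P3_gt0 := cP3_gt0 CG m_gt0 rp.
have P2_le := cP2_le rp rp' le_a le_b CF DG.
have P3_le := cP3_le rp rp' le_b CG.
have P23_lt : (cP2 CF DG a b < cP2 CF DG a' b') || (cP3 CG b < cP3 CG b').
  (* If [a] increases, [P2] does so strictly. Otherwise [a = a'], and some coordinate of [b] must
     increase, making [P3] strict, since the pairs would else coincide. *)
  have [lt_a|] := boolP (a < a').
    by rewrite (cP2_lt rp rp' le_b).
  rewrite lt_neqAle le_a andbT negbK => /eqP eq_a.
  have [/existsP[i lt_bi]|/existsPn nlt_b] := boolP [exists i, b i 0 < b' i 0].
    by rewrite (cP3_lt rp rp' le_b CG lt_bi) orbT.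
  case: neq_ab; congr (_, _) => //; apply/colP => i; apply/eqP.
  by rewrite eq_le le_b leNgt nlt_b.
by split; [exact: gamma_star_lt | exact: K_star_lt].
Qed.
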